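(* Let $(\mathbf{M}',\otimes,\mathbf{1},\chi)$ be a braided monoidal category, $\mathbf{M}:=\mathbf{Coalg}(\mathbf{M}')$ the monoidal category of coalgebras in $\mathbf{M}'$, $S$ a set, and $\mathbf{A},\mathbf{B}$ two $\mathbf{M}$-categories with object set $S$. Let $|\cdots|:S^3\to S$ be a function and let $\widetilde{R}=\{{}_x\widetilde{R}_z^y\}_{x,y,z\in S}$ be a family of coalgebra morphisms ${}_x\widetilde{R}_z^y:{}_xB_y\otimes{}_yA_z\to{}_xA_{|xyz|}\otimes{}_{|xyz|}B_z$. Put $${}_x\triangleright_z^y:=({}_xA_{|xyz|}\otimes{}_{|xyz|}\varepsilon_z^B)\circ{}_x\widetilde{R}_z^y:{}_xB_y\otimes{}_yA_z\to{}_xA_{|xyz|},\qquad {}_x\triangleleft_z^y:=({}_x\varepsilon_{|xyz|}^A\otimes{}_{|xyz|}B_z)\circ{}_x\widetilde{R}_z^y:{}_xB_y\otimes{}_yA_z\to{}_{|xyz|}B_z .$$ Then $(\widetilde{R},|\cdots|)$ is a simple twisting system in $\mathbf{M}'$ (between $\mathbf{B}$ and $\mathbf{A}$, regarded as $\mathbf{M}'$-categories) if and only if for all $x,y,z,t\in S$ the following conditions hold: (i) If ${}_xB_y\otimes{}_yA_z$ is not an initial object, then ${}_xA_{|xyz|}\otimes{}_{|xyz|}B_z$ is not an initial object. (ii) If ${}_xB_y\otimes{}_yB_z\otimes{}_zA_t$ is not an initial object in $\mathbf{M}'$, then $|xy|yzt||=|xzt|$ and $${}_x\triangleleft_t^z\circ({}_xb_z^y\otimes{}_zA_t)={}_{|xzt|}b_t^{|yzt|}\circ({}_x\triangleleft_{|yzt|}^y\otimes{}_{|yzt|}B_t)\circ({}_xB_y\otimes{}_y\triangleright_t^z\otimes{}_y\triangleleft_t^z)\circ({}_xB_y\otimes\Delta_{{}_yB_z\otimes{}_zA_t}),$$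 $${}_x\triangleright_t^z\circ({}_xb_z^y\otimes{}_zA_t)={}_x\triangleright_{|yzt|}^y\circ({}_xB_y\otimes{}_y\triangleright_t^z).$$ (iii) If ${}_xB_y\otimes{}_yA_z\otimes{}_zA_t$ is not an initial object in $\mathbf{M}'$, then $||xyz|zt|=|xyt|$ and $${}_x\triangleright_t^y\circ({}_xB_y\otimes{}_ya_t^z)={}_xa_{|xyt|}^{|xyz|}\circ({}_xA_{|xyz|}\otimes{}_{|xyz|}\triangleright_t^z)\circ({}_x\triangleright_z^y\otimes{}_x\triangleleft_z^y\otimes{}_zA_t)\circ(\Delta_{{}_xB_y\otimes{}_yA_z}\otimes{}_zA_t),$$ $${}_x\triangleleft_t^y\circ({}_xB_y\otimes{}_ya_t^z)={}_{|xyz|}\triangleleft_t^z\circ({}_x\triangleleft_z^y\otimes{}_zA_t).$$ (iv) If ${}_xA_y$ is not an initial object in $\mathbf{M}'$, then $|xxy|=y$ and $${}_x\triangleleft_y^x\circ(1_x^B\otimes{}_xA_y)={}_x\varepsilon_y^A\otimes1_y^B,\qquad {}_x\triangleright_y^x\circ(1_x^B\otimes{}_xA_y)={}_xA_y.$$ (v) If ${}_xB_y$ is not an initial object in $\mathbf{M}'$, then $|xyy|=x$ and $${}_x\triangleleft_y^y\circ({}_xB_y\otimes1_y^A)={}_xB_y,\qquad {}_x\triangleright_y^y\circ({}_xB_y\otimes1_y^A)=1_x^A\otimes{}_x\varepsilon_y^B.$$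
   Context: Associativity and unit constraints are suppressed, and the identity morphism of an object $X$ is also denoted $X$. $\mathbf{Coalg}(\mathbf{M}')$ is the category of coassociative counital coalgebras in $\mathbf{M}'$, monoidal with $\Delta_{C\otimes D}=(C\otimes\chi_{C,D}\otimes D)\circ(\Delta_C\otimes\Delta_D)$ and $\varepsilon_{C\otimes D}=\varepsilon_C\otimes\varepsilon_D$. For a monoidal category $\mathbf{N}$, an $\mathbf{N}$-category $\mathbf{A}$ with object set $S$ consists of objects ${}_xA_y$ of $\mathbf{N}$ (playing the role of $\mathrm{Hom}(y,x)$), composition morphisms ${}_xa_z^y:{}_xA_y\otimes{}_yA_z\to{}_xA_z$ and identities $1_x^A:\mathbf{1}\to{}_xA_x$, satisfying the usual associativity and unit axioms; for $\mathbf{B}$ the data are ${}_xB_y,{}_xb_z^y,1_x^B$. For $\mathbf{N}=\mathbf{Coalg}(\mathbf{M}')$ the hom-objects are coalgebras $({}_xA_y,{}_x\Delta_y^A,{}_x\varepsilon_y^A)$, $({}_xB_y,{}_x\Delta_y^B,{}_x\varepsilon_y^B)$, and compositions and identities are coalgebra morphisms; forgetting the coalgebra structures gives $\mathbf{M}'$-categories. A pair $(\widetilde{R},|\cdots|)$, with $|\cdots|:S^3\to S$ a function and ${}_x\widetilde{R}_z^y:{}_xB_y\otimes{}_yA_z\to{}_xA_{|xyz|}\otimes{}_{|xyz|}B_z$ morphisms in $\mathbf{M}'$, is a simple twisting system in $\mathbf{M}'$ between $\mathbf{B}$ and $\mathbf{A}$ if, for all $x,y,z,t\in S$ (''initial''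 meaning initial in $\mathbf{M}'$): (1) if ${}_xB_y\otimes{}_yB_z\otimes{}_zA_t$ is not initial, then $|xy|yzt||=|xzt|$ and $({}_xA_{|xzt|}\otimes{}_{|xzt|}b_t^{|yzt|})\circ({}_x\widetilde{R}_{|yzt|}^y\otimes{}_{|yzt|}B_t)\circ({}_xB_y\otimes{}_y\widetilde{R}_t^z)={}_x\widetilde{R}_t^z\circ({}_xb_z^y\otimes{}_zA_t)$; (2) if ${}_xB_y\otimes{}_yA_z\otimes{}_zA_t$ is not initial, then $||xyz|zt|=|xyt|$ and $({}_xa_{|xyt|}^{|xyz|}\otimes{}_{|xyt|}B_t)\circ({}_xA_{|xyz|}\otimes{}_{|xyz|}\widetilde{R}_t^z)\circ({}_x\widetilde{R}_z^y\otimes{}_zA_t)={}_x\widetilde{R}_t^y\circ({}_xB_y\otimes{}_ya_t^z)$; (3) if ${}_xA_y$ is not initial, then $|xxy|=y$ and ${}_x\widetilde{R}_y^x\circ(1_x^B\otimes{}_xA_y)={}_xA_y\otimes1_y^B$; (4) if ${}_xB_y$ is not initial, then $|xyy|=x$ and ${}_x\widetilde{R}_y^y\circ({}_xB_y\otimes1_y^A)=1_x^A\otimes{}_xB_y$; (5) if ${}_xB_y\otimes{}_yA_z$ is not initial, then ${}_xA_{|xyz|}\otimes{}_{|xyz|}B_z$ is not initial. *)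

(* Defs.v *)
From Corelib Require Import ssreflect ssrfun.
From Stdlib Require Import ProofIrrelevance.
Export EqNotations.

Set Implicit Arguments.
Unset Strict Implicit.
Unset Printing Implicit Defensive.
Set Bullet Behavior "None".

Declare Scope cat_scope.
Delimit Scope cat_scope with cat.
Open Scope cat_scope.

Record category := Category {
  Obj :> Type;
  Hom : Obj -> Obj -> Type;
  idm : forall X, Hom X X;
  comp : forall X Y Z, Hom Y Z -> Hom X Y -> Hom X Z;
  comp_idl : forall X Y (f : Hom X Y), comp (idm Y) f = f;
  comp_idr : forall X Y (f : Hom X Y), comp f (idm X) = f;
  comp_assoc : forall W X Y Z (h : Hom Y Z) (g : Hom X Y) (f : Hom W X),
    comp h (comp g f) = comp (comp h g) f
}.

Arguments Hom {c} X Y.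
Arguments idm {c} X.
Arguments comp {c X Y Z} g f.

Notation "g ∘ f" := (comp g f) (at level 45, left associativity) : cat_scope.

Definition initial (C : category) (X : C) : Prop :=
  forall Y : C, exists! f : Hom X Y, True.

Record monoidal := Monoidal {
  mcat :> category;
  tens : mcat -> mcat -> mcat;
  tensm : forall X X' Y Y' : mcat,
    Hom X X' -> Hom Y Y' -> Hom (tens X Y) (tens X' Y');
  unit : mcat;
  assoc : forall X Y Z, Hom (tens (tens X Y) Z) (tens X (tens Y Z));
  associ : forall X Y Z, Hom (tens X (tens Y Z)) (tens (tens X Y) Z);
  lunit : forall X, Hom (tens unit X) X;
  luniti : forall X, Hom X (tens unit X);
  runit : forall X, Hom (tens X unit) X;
  runiti : forall X, Hom X (tens X unit);
  tensm_id : forall X Y, tensm (idm X) (idm Y) = idm (tens X Y);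
  tensm_comp : forall X X' X'' Y Y' Y'' (f' : Hom X' X'') (f : Hom X X')
      (g' : Hom Y' Y'') (g : Hom Y Y'),
    tensm (f' ∘ f) (g' ∘ g) = tensm f' g' ∘ tensm f g;
  assoc_nat : forall X X' Y Y' Z Z' (f : Hom X X') (g : Hom Y Y')
      (h : Hom Z Z'),
    assoc X' Y' Z' ∘ tensm (tensm f g) h
    = tensm f (tensm g h) ∘ assoc X Y Z;
  lunit_nat : forall X Y (f : Hom X Y),
    lunit Y ∘ tensm (idm unit) f = f ∘ lunit X;
  runit_nat : forall X Y (f : Hom X Y),
    runit Y ∘ tensm f (idm unit) = f ∘ runit X;
  assocK : forall X Y Z, associ X Y Z ∘ assoc X Y Z = idm _;
  associK : forall X Y Z, assoc X Y Z ∘ associ X Y Z = idm _;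
  lunitK : forall X, luniti X ∘ lunit X = idm _;
  lunitiK : forall X, lunit X ∘ luniti X = idm _;
  runitK : forall X, runiti X ∘ runit X = idm _;
  runitiK : forall X, runit X ∘ runiti X = idm _;
  triangle : forall X Y,
    tensm (idm X) (lunit Y) ∘ assoc X unit Y = tensm (runit X) (idm Y);
  pentagon : forall W X Y Z,
    assoc W X (tens Y Z) ∘ assoc (tens W X) Y Z
    = tensm (idm W) (assoc X Y Z) ∘ assoc W (tens X Y) Z
        ∘ tensm (assoc W X Y) (idm Z)
}.

Arguments tens {m} X Y.
Arguments tensm {m X X' Y Y'} f g.
Arguments unit {m}.
Arguments assoc {m} X Y Z.
Arguments associ {m} X Y Z.
Arguments lunit {m} X.
Arguments luniti {m} X.
Arguments runit {m} X.
Arguments runiti {m} X.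

Notation "X ⊗ Y" := (tens X Y) (at level 40, left associativity) : cat_scope.
Notation "f ⊠ g" := (tensm f g) (at level 40, left associativity) : cat_scope.
Notation "𝟏" := unit : cat_scope.

Record braided := Braided {
  bmon :> monoidal;
  braid : forall X Y : bmon, Hom (X ⊗ Y) (Y ⊗ X);
  braidi : forall X Y : bmon, Hom (Y ⊗ X) (X ⊗ Y);
  braidK : forall X Y, braidi X Y ∘ braid X Y = idm _;
  braidiK : forall X Y, braid X Y ∘ braidi X Y = idm _;
  braid_nat : forall X X' Y Y' (f : Hom X X') (g : Hom Y Y'),
    braid X' Y' ∘ (f ⊠ g) = (g ⊠ f) ∘ braid X Y;
  hexagon1 : forall X Y Z,
    assoc Y Z X ∘ braid X (Y ⊗ Z) ∘ assoc X Y Z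
    = (idm Y ⊠ braid X Z) ∘ assoc Y X Z ∘ (braid X Y ⊠ idm Z);
  hexagon2 : forall X Y Z,
    associ Z X Y ∘ braid (X ⊗ Y) Z ∘ associ X Y Z
    = (braid X Z ⊠ idm Y) ∘ associ X Z Y ∘ (idm X ⊠ braid Y Z)
}.

Arguments braid {b} X Y.
Arguments braidi {b} X Y.

(* Strictification.  A word [u] is a bracketed tensor product, and [wact u Z]
   is the right-nested product of its letters with [Z].  A morphism [f] between
   words induces [lift u v f Z : wact u Z -> wact v Z]; lifting is faithful and
   turns all associativity and unit constraints into identities, so equations
   between morphisms can be proved as in a strict monoidal category. *)
Section Strictification.
Variable M : monoidal.

Lemma compA2 (W X Y Y' Z : M) (h : Hom Y Z) (g : Hom X Y) (h' : Hom Y' Z)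
    (g' : Hom X Y') (f : Hom W X) :
  h ∘ g = h' ∘ g' -> h ∘ (g ∘ f) = h' ∘ (g' ∘ f).
Proof. by move=> E; rewrite !comp_assoc E. Qed.

Lemma compK (W X Y : M) (h : Hom Y X) (g : Hom X Y) (f : Hom W X) :
  h ∘ g = idm X -> h ∘ (g ∘ f) = f.
Proof. by move=> E; rewrite comp_assoc E comp_idl. Qed.

Lemma epi_iso (W X Y : M) (f : Hom W X) (f' : Hom X W) (g h : Hom X Y) :
  f ∘ f' = idm X -> g ∘ f = h ∘ f -> g = h.
Proof.
by move=> fK E; rewrite -(comp_idr g) -(comp_idr h) -fK !comp_assoc E.
Qed.

Lemma mono_iso (X Y Z : M) (f : Hom Y Z) (f' : Hom Z Y) (g h : Hom X Y) :
  f' ∘ f = idm Y -> f ∘ g = f ∘ h -> g = h.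
Proof.
by move=> fK E; rewrite -(comp_idl g) -(comp_idl h) -fK -!comp_assoc E.
Qed.

Lemma tensm_idl_comp (X Y Y' Y'' : M) (g' : Hom Y' Y'') (g : Hom Y Y') :
  idm X ⊠ (g' ∘ g) = (idm X ⊠ g') ∘ (idm X ⊠ g).
Proof. by rewrite -tensm_comp comp_idl. Qed.

Lemma tensm_idr_comp (X Y Y' Y'' : M) (g' : Hom Y' Y'') (g : Hom Y Y') :
  (g' ∘ g) ⊠ idm X = (g' ⊠ idm X) ∘ (g ⊠ idm X).
Proof. by rewrite -tensm_comp comp_idl. Qed.

Lemma tensm_split (X X' Y Y' : M) (f : Hom X X') (g : Hom Y Y') :
  f ⊠ g = (f ⊠ idm Y') ∘ (idm X ⊠ g).
Proof. by rewrite -tensm_comp comp_idl comp_idr. Qed.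

Lemma tensm_split' (X X' Y Y' : M) (f : Hom X X') (g : Hom Y Y') :
  f ⊠ g = (idm X' ⊠ g) ∘ (f ⊠ idm Y).
Proof. by rewrite -tensm_comp comp_idl comp_idr. Qed.

Lemma tens1_inj (X Y : M) (f g : Hom X Y) :
  idm 𝟏 ⊠ f = idm 𝟏 ⊠ g -> f = g.
Proof.
move=> E; apply: (epi_iso (lunitiK X)).
by rewrite -!lunit_nat E.
Qed.

Lemma tensr1_inj (X Y : M) (f g : Hom X Y) :
  f ⊠ idm 𝟏 = g ⊠ idm 𝟏 -> f = g.
Proof.
move=> E; apply: (epi_iso (runitiK X)).
by rewrite -!runit_nat E.
Qed.

Lemma lunit_tens (X Y : M) : lunit (X ⊗ Y) ∘ assoc 𝟏 X Y = lunit X ⊠ idm Y.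
Proof.
apply: tens1_inj; rewrite tensm_idl_comp.
apply: (@epi_iso _ _ _ (assoc 𝟏 (𝟏 ⊗ X) Y) _ _ _ (associK _ _ _)).
apply: (@epi_iso _ _ _ (assoc 𝟏 𝟏 X ⊠ idm Y) (associ 𝟏 𝟏 X ⊠ idm Y)).
  by rewrite -tensm_idr_comp associK tensm_id.
rewrite -!comp_assoc (comp_assoc (idm _ ⊠ assoc _ _ _)) -pentagon.
rewrite comp_assoc triangle -{1}tensm_id -assoc_nat -triangle tensm_idr_comp.
by rewrite !comp_assoc assoc_nat.
Qed.

Inductive word :=
  | W1
  | Wa of M
  | Wt of word & word.

Fixpoint wobj (u : word) : M :=
  match u with
  | W1 => 𝟏
  | Wa X => X
  | Wt u v => wobj u ⊗ wobj v
  end.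

Fixpoint wact (u : word) (Z : M) : M :=
  match u with
  | W1 => Z
  | Wa X => X ⊗ Z
  | Wt u v => wact u (wact v Z)
  end.

Fixpoint wactm (u : word) (Z Z' : M) (f : Hom Z Z') :
    Hom (wact u Z) (wact u Z') :=
  match u with
  | W1 => f
  | Wa X => idm X ⊠ f
  | Wt u v => wactm u (wactm v f)
  end.

Fixpoint wn (u : word) (Z : M) : Hom (wobj u ⊗ Z) (wact u Z) :=
  match u with
  | W1 => lunit Z
  | Wa X => idm (X ⊗ Z)
  | Wt u v => wn u (wact v Z) ∘ (idm (wobj u) ⊠ wn v Z) ∘ assoc _ _ _
  end.

Fixpoint wni (u : word) (Z : M) : Hom (wact u Z) (wobj u ⊗ Z) :=
  match u with
  | W1 => luniti Z
  | Wa X => idm (X ⊗ Z)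
  | Wt u v => associ _ _ _ ∘ ((idm (wobj u) ⊠ wni v Z) ∘ wni u (wact v Z))
  end.

Lemma wactm_id u Z : wactm u (idm Z) = idm (wact u Z).
Proof.
elim: u Z => [//|X|u IHu v IHv] Z /=; first exact: tensm_id.
by rewrite IHv IHu.
Qed.

Lemma wactm_comp u (Z Z' Z'' : M) (g : Hom Z' Z'') (f : Hom Z Z') :
  wactm u (g ∘ f) = wactm u g ∘ wactm u f.
Proof.
elim: u Z Z' Z'' g f => [//|X|u IHu v IHv] Z Z' Z'' g f /=.
  exact: tensm_idl_comp.
by rewrite IHv IHu.
Qed.

Lemma wnK u Z : wni u Z ∘ wn u Z = idm _.
Proof.
elim: u Z => [|X|u IHu v IHv] Z /=; rewrite ?lunitK ?comp_idl //.
rewrite -!comp_assoc (compK _ (IHu _)).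
rewrite (comp_assoc (idm _ ⊠ _)) -tensm_idl_comp IHv tensm_id comp_idl.
exact: assocK.
Qed.

Lemma wniK u Z : wn u Z ∘ wni u Z = idm _.
Proof.
elim: u Z => [|X|u IHu v IHv] Z /=; rewrite ?lunitiK ?comp_idl //.
rewrite -!comp_assoc (compK _ (associK _ _ _)).
by rewrite (comp_assoc (idm _ ⊠ _)) -tensm_idl_comp IHv tensm_id comp_idl IHu.
Qed.

Lemma wn_nat u (Z Z' : M) (f : Hom Z Z') :
  wn u Z' ∘ (idm (wobj u) ⊠ f) = wactm u f ∘ wn u Z.
Proof.
elim: u Z Z' f => [|X|u IHu v IHv] Z Z' f /=.
- exact: lunit_nat.
- by rewrite comp_idl comp_idr.
rewrite -!comp_assoc -tensm_id assoc_nat.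
rewrite (comp_assoc (idm _ ⊠ _)) -tensm_idl_comp IHv tensm_idl_comp.
by rewrite !comp_assoc IHu.
Qed.

(* Sealed behind [Qed] so that unification never unfolds [lift]. *)
Lemma lift_sig u v (f : Hom (wobj u) (wobj v)) Z :
  {g : Hom (wact u Z) (wact v Z) | g ∘ wn u Z = wn v Z ∘ (f ⊠ idm Z)}.
Proof.
exists (wn v Z ∘ ((f ⊠ idm Z) ∘ wni u Z)).
by rewrite -!comp_assoc wnK comp_idr.
Qed.

Definition lift u v (f : Hom (wobj u) (wobj v)) (Z : M) :
    Hom (wact u Z) (wact v Z) :=
  proj1_sig (lift_sig f Z).

Lemma liftE u v (f : Hom (wobj u) (wobj v)) Z :
  lift f Z ∘ wn u Z = wn v Z ∘ (f ⊠ idm Z).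
Proof. exact: proj2_sig (lift_sig f Z). Qed.

Lemma lift_eq u v (f : Hom (wobj u) (wobj v)) Z g :
  wn v Z ∘ (f ⊠ idm Z) = g ∘ wn u Z -> lift f Z = g.
Proof. by rewrite -liftE; apply: epi_iso; apply: wniK. Qed.

Lemma lift_inj u v (f g : Hom (wobj u) (wobj v)) :
  (forall Z, lift f Z = lift g Z) -> f = g.
Proof.
move=> /(_ 𝟏) E; apply: tensr1_inj.
by apply: (mono_iso (wnK v _)); rewrite -!liftE E.
Qed.

Lemma lift_nat u v (f : Hom (wobj u) (wobj v)) (Z Z' : M) (h : Hom Z Z') :
  lift f Z' ∘ wactm u h = wactm v h ∘ lift f Z.
Proof.
apply: (epi_iso (wniK u Z)); rewrite -!comp_assoc. rewrite liftE -wn_nat.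
rewrite (compA2 _ (liftE _ _)) -tensm_split tensm_split'.
by rewrite !comp_assoc wn_nat.
Qed.

Lemma lift_id u Z : @lift u u (idm _) Z = idm _.
Proof. by apply: lift_eq; rewrite tensm_id comp_idl comp_idr. Qed.

Lemma lift_comp u v w (g : Hom (wobj v) (wobj w)) (f : Hom (wobj u) (wobj v))
    Z :
  @lift u w (g ∘ f) Z = lift g Z ∘ lift f Z.
Proof.
by apply: lift_eq; rewrite -comp_assoc liftE !comp_assoc liftE tensm_idr_comp
  comp_assoc.
Qed.

Lemma lift_tensm u u' v v' (f : Hom (wobj u) (wobj u'))
    (g : Hom (wobj v) (wobj v')) Z :
  @lift (Wt u v) (Wt u' v') (f ⊠ g) Z
  = lift f (wact v' Z) ∘ wactm u (lift g Z).
Proof.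
apply: lift_eq => /=; rewrite -!comp_assoc assoc_nat.
rewrite (compA2 _ (esym (wn_nat _ _))) (compA2 _ (liftE _ _)).
congr (_ ∘ _); rewrite !comp_assoc; congr (_ ∘ _).
by rewrite -!tensm_comp !comp_idl !comp_idr liftE.
Qed.

Lemma lift_assoc u v w Z :
  @lift (Wt (Wt u v) w) (Wt u (Wt v w)) (assoc _ _ _) Z = idm _.
Proof.
apply: lift_eq => /=; rewrite comp_idl !tensm_idl_comp -!comp_assoc.
congr (_ ∘ _); rewrite (comp_assoc (idm _ ⊠ assoc _ _ _)) -pentagon.
congr (_ ∘ _); rewrite -tensm_id !comp_assoc assoc_nat.
by rewrite -!comp_assoc.
Qed.

Lemma lift_inv u v (f : Hom (wobj u) (wobj v)) (g : Hom (wobj v) (wobj u)) Z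
    h h' :
  f ∘ g = idm _ -> h' ∘ h = idm _ -> lift f Z = h -> lift g Z = h'.
Proof.
move=> fg hh Ef; apply: (@mono_iso _ _ _ h h') => //.
rewrite -Ef -lift_comp fg lift_id.
have: lift f Z ∘ h' = lift f Z ∘ h' ∘ (lift f Z ∘ lift g Z).
  by rewrite -lift_comp fg lift_id comp_idr.
by rewrite Ef !comp_assoc -(comp_assoc h) hh comp_idr -{2}Ef -lift_comp fg
  lift_id => ->.
Qed.

Lemma lift_associ u v w Z :
  @lift (Wt u (Wt v w)) (Wt (Wt u v) w) (associ _ _ _) Z = idm _.
Proof.
apply: (lift_inv (f := assoc _ _ _ : Hom (wobj (Wt (Wt u v) w))
  (wobj (Wt u (Wt v w)))) (h := idm _)).
- exact: associK.
- exact: comp_idl.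
exact: lift_assoc.
Qed.

Lemma lift_lunit u Z : @lift (Wt W1 u) u (lunit _) Z = idm _.
Proof.
apply: lift_eq => /=.
by rewrite comp_idl lunit_nat -!comp_assoc lunit_tens.
Qed.

Lemma lift_luniti u Z : @lift u (Wt W1 u) (luniti _) Z = idm _.
Proof.
apply: (lift_inv (f := lunit _ : Hom (wobj (Wt W1 u)) (wobj u))
  (h := idm _)).
- exact: lunitiK.
- exact: comp_idl.
exact: lift_lunit.
Qed.

Lemma lift_runit u Z : @lift (Wt u W1) u (runit _) Z = idm _.
Proof. by apply: lift_eq => /=; rewrite comp_idl -!comp_assoc triangle. Qed.

Lemma lift_runiti u Z : @lift u (Wt u W1) (runiti _) Z = idm _.
Proof.
apply: (lift_inv (f := runit _ : Hom (wobj (Wt u W1)) (wobj u))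
  (h := idm _)).
- exact: runitiK.
- exact: comp_idl.
exact: lift_runit.
Qed.

Inductive mor : word -> word -> Type :=
  | Matom u v (f : Hom (wobj u) (wobj v)) : mor u v
  | Mid u : mor u u
  | Mc u v w (g : mor v w) (f : mor u v) : mor u w
  | Mt u u' v v' (f : mor u u') (g : mor v v') : mor (Wt u v) (Wt u' v')
  | Ma u v w : mor (Wt (Wt u v) w) (Wt u (Wt v w))
  | Mai u v w : mor (Wt u (Wt v w)) (Wt (Wt u v) w)
  | Ml u : mor (Wt W1 u) u
  | Mli u : mor u (Wt W1 u)
  | Mr u : mor (Wt u W1) u
  | Mri u : mor u (Wt u W1).

Arguments Matom {u v} f.
Arguments Mc {u v w} g f.
Arguments Mt {u u' v v'} f g.

Fixpoint meval u v (f : mor u v) : Hom (wobj u) (wobj v) :=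
  match f with
  | Matom f => f
  | Mid u => idm _
  | Mc g f => meval g ∘ meval f
  | Mt f g => meval f ⊠ meval g
  | Ma u v w => assoc _ _ _
  | Mai u v w => associ _ _ _
  | Ml u => lunit _
  | Mli u => luniti _
  | Mr u => runit _
  | Mri u => runiti _
  end.

Fixpoint mlift u v (f : mor u v) (Z : M) : Hom (wact u Z) (wact v Z) :=
  match f with
  | Matom f => lift f Z
  | Mid u => idm _
  | Mc g f => mlift g Z ∘ mlift f Z
  | @Mt u _ _ v' f g => mlift f (wact v' Z) ∘ wactm u (mlift g Z)
  | Ma u v w => idm _
  | Mai u v w => idm _
  | Ml u => idm _
  | Mli u => idm _
  | Mr u => idm _
  | Mri u => idm _
  end.

Lemma mliftE u v (f : mor u v) Z : lift (meval f) Z = mlift f Z.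
Proof.
elim: f Z => {u v} [||u v w g IHg f IHf|u u' v v' f IHf g IHg||||||] //= *.
- exact: lift_id.
- by rewrite lift_comp IHg IHf.
- by rewrite lift_tensm IHf IHg.
- exact: lift_assoc.
- exact: lift_associ.
- exact: lift_lunit.
- exact: lift_luniti.
- exact: lift_runit.
exact: lift_runiti.
Qed.

Lemma strictify u v (f g : mor u v) :
  (forall Z, mlift f Z = mlift g Z) -> meval f = meval g.
Proof. by move=> E; apply: lift_inj => Z; rewrite !mliftE E. Qed.

Lemma strictify_hyp u v (f g : mor u v) :
  meval f = meval g -> forall Z, mlift f Z = mlift g Z.
Proof. by move=> E Z; rewrite -!mliftE E. Qed.

End Strictification.

Arguments W1 {M}.
Arguments Wa {M}.
Arguments lift {M} u v f Z.
Arguments wactm {M} u {Z Z'} f.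
Arguments Mid {M} u.
Arguments Matom {M} u v f.

Ltac reify_obj X :=
  lazymatch X with
  | tens ?A ?B =>
      let a := reify_obj A in let b := reify_obj B in constr:(Wt a b)
  | @unit ?M => constr:(@W1 M)
  | _ => constr:(Wa X)
  end.

Ltac reify_mor f :=
  lazymatch f with
  | comp ?g ?h =>
      let a := reify_mor g in let b := reify_mor h in constr:(Mc a b)
  | tensm ?g ?h =>
      let a := reify_mor g in let b := reify_mor h in constr:(Mt a b)
  | idm ?X => let u := reify_obj X in constr:(Mid u)
  | assoc ?X ?Y ?Z =>
      let u := reify_obj X in let v := reify_obj Y in let w := reify_obj Z in
      constr:(Ma u v w)
  | associ ?X ?Y ?Z =>
      let u := reify_obj X in let v := reify_obj Y in let w := reify_obj Z in
      constr:(Mai u v w)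
  | lunit ?X => let u := reify_obj X in constr:(Ml u)
  | luniti ?X => let u := reify_obj X in constr:(Mli u)
  | runit ?X => let u := reify_obj X in constr:(Mr u)
  | runiti ?X => let u := reify_obj X in constr:(Mri u)
  | _ =>
      lazymatch type of f with
      | @Hom _ ?X ?Y =>
          let u := reify_obj X in let v := reify_obj Y in
          constr:(Matom u v f)
      end
  end.

Ltac simpl_strict :=
  cbn [mlift wact wactm wobj];
  rewrite ?tensm_id ?comp_idl ?comp_idr ?tensm_id ?comp_idl ?comp_idr.

(* Turns an equation into the corresponding equation of lifted morphisms. *)
Ltac strict_goal W :=
  lazymatch goal with
  | |- ?f = ?g =>
      let a := reify_mor f in let b := reify_mor g in
      refine (@strictify _ _ _ a b _); intro W; simpl_strict
  end.

Ltac strict_of E H :=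
  lazymatch type of E with
  | ?f = ?g =>
      let a := reify_mor f in let b := reify_mor g in
      pose proof (@strictify_hyp _ _ _ a b E) as H;
      cbn [mlift wact wactm wobj] in H
  end.

Section BraidedStrict.
Variable M : braided.
Implicit Types u v w : word M.

Definition sbraid u v (Z : M) : Hom (wact u (wact v Z)) (wact v (wact u Z)) :=
  lift (Wt u v) (Wt v u) (braid (wobj u) (wobj v)) Z.

Lemma sbraid_nat u u' v v' (f : Hom (wobj u) (wobj u'))
    (g : Hom (wobj v) (wobj v')) Z :
  sbraid u' v' Z ∘ (lift u u' f (wact v' Z) ∘ wactm u (lift v v' g Z))
  = lift v v' g (wact u' Z) ∘ wactm v (lift u u' f Z) ∘ sbraid u v Z.
Proof.
by rewrite /sbraid -!lift_tensm -!(@lift_comp _ (Wt _ _) (Wt _ _) (Wt _ _))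
  braid_nat.
Qed.

Lemma sbraid_hex1 u v w Z :
  sbraid u (Wt v w) Z = wactm v (sbraid u w Z) ∘ sbraid u v (wact w Z).
Proof.
have E := hexagon1 (wobj u) (wobj v) (wobj w).
have /= := @strictify_hyp _ _ _
  (Mc (Mc (Ma v w u) (@Matom _ (Wt u (Wt v w)) (Wt (Wt v w) u) (braid _ _)))
      (Ma u v w))
  (Mc (Mc (Mt (Mid v) (@Matom _ (Wt u w) (Wt w u) (braid _ _))) (Ma v u w))
      (Mt (@Matom _ (Wt u v) (Wt v u) (braid _ _)) (Mid w))) E Z.
by rewrite !comp_idl !comp_idr !wactm_id !comp_idr.
Qed.

Lemma sbraid_hex2 u v w Z :
  sbraid (Wt u v) w Z = sbraid u w (wact v Z) ∘ wactm u (sbraid v w Z).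
Proof.
have E := hexagon2 (wobj u) (wobj v) (wobj w).
have /= := @strictify_hyp _ _ _
  (Mc (Mc (Mai w u v) (@Matom _ (Wt (Wt u v) w) (Wt w (Wt u v)) (braid _ _)))
      (Mai u v w))
  (Mc (Mc (Mt (@Matom _ (Wt u w) (Wt w u) (braid _ _)) (Mid v)) (Mai u w v))
      (Mt (Mid u) (@Matom _ (Wt v w) (Wt w v) (braid _ _)))) E Z.
by rewrite !comp_idl !comp_idr !wactm_id !comp_idr.
Qed.

Lemma sbraid_iso u v Z :
  exists g : Hom (wact v (wact u Z)) (wact u (wact v Z)),
    g ∘ sbraid u v Z = idm _.
Proof.
exists (lift (Wt v u) (Wt u v) (braidi (wobj u) (wobj v)) Z).
by rewrite -(@lift_comp _ (Wt u v) (Wt v u) (Wt u v)) braidK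
  (@lift_id _ (Wt u v)).
Qed.

Lemma idem_iso (X : M) (f g : Hom X X) : g ∘ f = idm X -> f = f ∘ f -> f = idm X.
Proof. by move=> gf ff; rewrite -gf {2}ff comp_assoc gf comp_idl. Qed.

Lemma sbraid1r u Z : sbraid u W1 Z = idm _.
Proof.
have [g gK] := sbraid_iso u W1 Z.
apply: (idem_iso gK); rewrite -{1}[sbraid u W1 Z]comp_idr.
have := @sbraid_nat u u (Wt W1 W1) W1 (idm _) (lunit _) Z.
rewrite (@lift_lunit _ W1) (@lift_lunit _ W1) !lift_id !wactm_id !comp_idl.
by move=> ->; rewrite sbraid_hex1.
Qed.

Lemma sbraid1l u Z : sbraid W1 u Z = idm _.
Proof.
have [g gK] := sbraid_iso W1 u Z.
apply: (idem_iso gK); rewrite -{1}[sbraid W1 u Z]comp_idr.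
have := @sbraid_nat (Wt W1 W1) W1 u u (lunit _) (idm _) Z.
rewrite (@lift_lunit _ W1) (@lift_lunit _ W1) !lift_id !wactm_id !comp_idl.
by move=> ->; rewrite sbraid_hex2.
Qed.

Lemma sbraid_natl u u' v (f : Hom (wobj u) (wobj u')) Z :
  sbraid u' v Z ∘ lift u u' f (wact v Z)
  = wactm v (lift u u' f Z) ∘ sbraid u v Z.
Proof.
have := @sbraid_nat u u' v v f (idm _) Z.
by rewrite !lift_id wactm_id comp_idr comp_idl.
Qed.

Lemma sbraid_natr u v v' (g : Hom (wobj v) (wobj v')) Z :
  sbraid u v' Z ∘ wactm u (lift v v' g Z)
  = lift v v' g (wact u Z) ∘ sbraid u v Z.
Proof.
have := @sbraid_nat u u v v' (idm _) g Z.
by rewrite !lift_id wactm_id comp_idr comp_idl.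
Qed.

Lemma sbraid_nat0 u v (Z Z' : M) (h : Hom Z Z') :
  sbraid u v Z' ∘ wactm u (wactm v h) = wactm v (wactm u h) ∘ sbraid u v Z.
Proof. exact: (@lift_nat _ (Wt u v) (Wt v u)). Qed.

(* The instances of naturality used below, stated on one-letter words. *)
Lemma slide11 (X X' Z Z' : M) (f : Hom X X') (h : Hom Z Z') :
  lift (Wa X) (Wa X') f Z' ∘ (idm X ⊠ h)
  = (idm X' ⊠ h) ∘ lift (Wa X) (Wa X') f Z.
Proof. exact: (@lift_nat _ (Wa X) (Wa X')). Qed.

Lemma slide10 (X Z Z' : M) (f : Hom X 𝟏) (h : Hom Z Z') :
  lift (Wa X) W1 f Z' ∘ (idm X ⊠ h) = h ∘ lift (Wa X) W1 f Z.
Proof. exact: (@lift_nat _ (Wa X) W1). Qed.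

Lemma slide12 (X Y Y' Z Z' : M) (f : Hom X (Y ⊗ Y')) (h : Hom Z Z') :
  lift (Wa X) (Wt (Wa Y) (Wa Y')) f Z' ∘ (idm X ⊠ h)
  = (idm Y ⊠ (idm Y' ⊠ h)) ∘ lift (Wa X) (Wt (Wa Y) (Wa Y')) f Z.
Proof. exact: (@lift_nat _ (Wa X) (Wt (Wa Y) (Wa Y'))). Qed.

Lemma slide_braid (X Y Z Z' : M) (h : Hom Z Z') :
  sbraid (Wa X) (Wa Y) Z' ∘ (idm X ⊠ (idm Y ⊠ h))
  = (idm Y ⊠ (idm X ⊠ h)) ∘ sbraid (Wa X) (Wa Y) Z.
Proof. exact: (@sbraid_nat0 (Wa X) (Wa Y)). Qed.

Lemma braid_l1 (X X' Y Z : M) (f : Hom X X') :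
  sbraid (Wa X') (Wa Y) Z ∘ lift (Wa X) (Wa X') f (Y ⊗ Z)
  = (idm Y ⊠ lift (Wa X) (Wa X') f Z) ∘ sbraid (Wa X) (Wa Y) Z.
Proof. exact: (@sbraid_natl (Wa X) (Wa X') (Wa Y)). Qed.

Lemma braid_r1 (X Y Y' Z : M) (f : Hom Y Y') :
  sbraid (Wa X) (Wa Y') Z ∘ (idm X ⊠ lift (Wa Y) (Wa Y') f Z)
  = lift (Wa Y) (Wa Y') f (X ⊗ Z) ∘ sbraid (Wa X) (Wa Y) Z.
Proof. exact: (@sbraid_natr (Wa X) (Wa Y) (Wa Y')). Qed.

Lemma braid_l0 (X Y Z : M) (f : Hom X 𝟏) :
  (idm Y ⊠ lift (Wa X) W1 f Z) ∘ sbraid (Wa X) (Wa Y) Z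
  = lift (Wa X) W1 f (Y ⊗ Z).
Proof.
have /= <- := @sbraid_natl (Wa X) W1 (Wa Y) f Z.
by rewrite sbraid1l comp_idl.
Qed.

Lemma braid_r0 (X Y Z : M) (f : Hom Y 𝟏) :
  lift (Wa Y) W1 f (X ⊗ Z) ∘ sbraid (Wa X) (Wa Y) Z
  = idm X ⊠ lift (Wa Y) W1 f Z.
Proof.
have /= <- := @sbraid_natr (Wa X) (Wa Y) W1 f Z.
by rewrite sbraid1r comp_idl.
Qed.

Lemma braid_l2 (X Y Z : M) (f : Hom X (X ⊗ X)) :
  (idm Y ⊠ lift (Wa X) (Wt (Wa X) (Wa X)) f Z) ∘ sbraid (Wa X) (Wa Y) Z
  = sbraid (Wa X) (Wa Y) (X ⊗ Z)
    ∘ ((idm X ⊠ sbraid (Wa X) (Wa Y) Z)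
       ∘ lift (Wa X) (Wt (Wa X) (Wa X)) f (Y ⊗ Z)).
Proof.
have /= <- := @sbraid_natl (Wa X) (Wt (Wa X) (Wa X)) (Wa Y) f Z.
by rewrite sbraid_hex2 comp_assoc.
Qed.

Lemma braid_r2 (X Y Z : M) (f : Hom Y (Y ⊗ Y)) :
  lift (Wa Y) (Wt (Wa Y) (Wa Y)) f (X ⊗ Z) ∘ sbraid (Wa X) (Wa Y) Z
  = (idm Y ⊠ sbraid (Wa X) (Wa Y) Z)
    ∘ (sbraid (Wa X) (Wa Y) (Y ⊗ Z)
       ∘ (idm X ⊠ lift (Wa Y) (Wt (Wa Y) (Wa Y)) f Z)).
Proof.
have /= <- := @sbraid_natr (Wa X) (Wa Y) (Wt (Wa Y) (Wa Y)) f Z.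
by rewrite sbraid_hex1 comp_assoc.
Qed.

End BraidedStrict.

Ltac nf := cbn [wact wactm wobj]; rewrite ?tensm_idl_comp -?comp_assoc.

Lemma cA (M : monoidal) (W X Y Z : M) (h : Hom Y Z) (g : Hom X Y)
    (k : Hom X Z) (f : Hom W X) :
  h ∘ g = k -> h ∘ (g ∘ f) = k ∘ f.
Proof. by move=> <-; rewrite comp_assoc. Qed.

Lemma wh (M : monoidal) (A W X Y Z : M) (h : Hom Y Z) (g : Hom X Y)
    (k : Hom X Z) (f : Hom W (A ⊗ X)) :
  h ∘ g = k -> (idm A ⊠ h) ∘ ((idm A ⊠ g) ∘ f) = (idm A ⊠ k) ∘ f.
Proof. by move=> <-; rewrite comp_assoc -tensm_idl_comp. Qed.

Ltac fold_braid :=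
  repeat match goal with
  | |- context [lift (Wt ?u ?v) ?w (braid ?X ?Y) ?Z] =>
      change (lift (Wt u v) w (braid X Y) Z) with (sbraid u v Z)
  end.

Section Coalgebras.
Variable M : braided.

Record coalgebra := Coalgebra {
  carrier : M;
  comul : Hom carrier (carrier ⊗ carrier);
  counit : Hom carrier 𝟏;
  coassoc : assoc _ _ _ ∘ (comul ⊠ idm carrier) ∘ comul
            = (idm carrier ⊠ comul) ∘ comul;
  counitl : lunit _ ∘ (counit ⊠ idm carrier) ∘ comul = idm carrier;
  counitr : runit _ ∘ (idm carrier ⊠ counit) ∘ comul = idm carrier
}.

Definition is_coalg_mor (C D : coalgebra) (f : Hom (carrier C) (carrier D)) :
    Prop :=
  comul D ∘ f = (f ⊠ f) ∘ comul C /\ counit D ∘ f = counit C.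

Record coalg_mor (C D : coalgebra) := CoalgMor {
  cmap :> Hom (carrier C) (carrier D);
  cmapP : is_coalg_mor cmap
}.

Lemma coalg_mor_eq (C D : coalgebra) (f g : coalg_mor C D) :
  cmap f = cmap g -> f = g.
Proof.
case: f g => [f Pf] [g Pg] /= E; move: E Pf Pg => -> Pf Pg.
by rewrite (proof_irrelevance _ Pf Pg).
Qed.

Lemma id_coalgP C : is_coalg_mor (C := C) (idm _).
Proof. by split; rewrite ?tensm_id ?comp_idl ?comp_idr. Qed.

Lemma comp_coalgP C D E (g : coalg_mor D E) (f : coalg_mor C D) :
  is_coalg_mor (C := C) (D := E) (cmap g ∘ cmap f).
Proof.
case: g f => [g [g1 g2]] [f [f1 f2]] /=; split; last first.
  by rewrite comp_assoc g2.
by rewrite comp_assoc g1 -comp_assoc f1 comp_assoc tensm_comp.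
Qed.

Definition coalg_cat : category.
Proof.
refine (@Category coalgebra coalg_mor (fun C => CoalgMor (id_coalgP C))
  (fun C D E g f => CoalgMor (comp_coalgP g f)) _ _ _);
  move=> *; apply: coalg_mor_eq => /=.
- exact: comp_idl.
- exact: comp_idr.
- exact: comp_assoc.
Defined.

(* [X ⊗ χ ⊗ Y] with its associativity constraints. *)
Definition interchange (X X' Y Y' : M) :
    Hom ((X ⊗ X') ⊗ (Y ⊗ Y')) ((X ⊗ Y) ⊗ (X' ⊗ Y')) :=
  associ _ _ _
  ∘ (idm X ⊠ (assoc _ _ _ ∘ (braid X' Y ⊠ idm Y') ∘ associ _ _ _))
  ∘ assoc _ _ _.

Lemma interchange_nat (X1 X1' Y1 Y1' X2 X2' Y2 Y2' : M) (f : Hom X1 X2)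
    (f' : Hom X1' X2') (g : Hom Y1 Y2) (g' : Hom Y1' Y2') :
  interchange X2 X2' Y2 Y2' ∘ ((f ⊠ f') ⊠ (g ⊠ g'))
  = ((f ⊠ g) ⊠ (f' ⊠ g')) ∘ interchange X1 X1' Y1 Y1'.
Proof.
rewrite /interchange; strict_goal W; fold_braid; nf.
rewrite (compA2 _ (esym (slide11 _ _))); nf; congr (_ ∘ _).
rewrite -!tensm_idl_comp; congr (_ ⊠ _); nf.
rewrite (compA2 _ (braid_l1 _ _ _)).
rewrite (compA2 _ (braid_r1 _ _ _)) slide_braid.
by do 3 (rewrite (cA _ (slide11 g _)); nf).
Qed.

Local Notation sΔ C Z :=
  (lift (Wa (carrier C)) (Wt (Wa (carrier C)) (Wa (carrier C))) (comul C) Z).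
Local Notation sε C Z := (lift (Wa (carrier C)) W1 (counit C) Z).

Lemma coassoc_strict (C : coalgebra) Z :
  sΔ C (carrier C ⊗ Z) ∘ sΔ C Z = (idm _ ⊠ sΔ C Z) ∘ sΔ C Z.
Proof.
strict_of (coassoc C) H; move: (H Z).
by rewrite !tensm_id !comp_idl comp_idr.
Qed.

Lemma counitl_strict (C : coalgebra) Z :
  sε C (carrier C ⊗ Z) ∘ sΔ C Z = idm _.
Proof.
strict_of (counitl C) H; move: (H Z).
by rewrite !tensm_id !comp_idl comp_idr.
Qed.

Lemma counitr_strict (C : coalgebra) Z :
  (idm _ ⊠ sε C Z) ∘ sΔ C Z = idm _.
Proof. by strict_of (counitr C) H; move: (H Z); rewrite !comp_idl. Qed.

Definition tcomul (C D : coalgebra) :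
    Hom (carrier C ⊗ carrier D)
        ((carrier C ⊗ carrier D) ⊗ (carrier C ⊗ carrier D)) :=
  interchange _ _ _ _ ∘ (comul C ⊠ comul D).

Definition tcounit (C D : coalgebra) : Hom (carrier C ⊗ carrier D) 𝟏 :=
  lunit 𝟏 ∘ (counit C ⊠ counit D).

Lemma tcoassoc C D :
  assoc _ _ _ ∘ (tcomul C D ⊠ idm _) ∘ tcomul C D
  = (idm _ ⊠ tcomul C D) ∘ tcomul C D.
Proof.
rewrite /tcomul /interchange; strict_goal W; fold_braid; nf.
rewrite (wh _ (braid_r2 _ _ (comul D))); nf.
do 3 (rewrite (cA _ (slide12 _ _)); nf).
rewrite slide12; do 1 (rewrite (cA _ (slide12 _ _)); nf).
rewrite (wh _ (slide_braid _ _ _)) (wh _ (esym (slide_braid _ _ (sΔ D W)))); nf.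
rewrite (wh _ (braid_l2 _ _ _)); nf.
do 2 (rewrite (wh _ (slide12 _ _)); nf).
rewrite -coassoc_strict.
do 3 congr (_ ∘ _).
rewrite !comp_assoc; congr (_ ∘ _); rewrite -!tensm_idl_comp.
by rewrite coassoc_strict.
Qed.

Lemma tcounitl C D :
  lunit _ ∘ (tcounit C D ⊠ idm _) ∘ tcomul C D = idm _.
Proof.
rewrite /tcomul /tcounit /interchange; strict_goal W; fold_braid; nf.
rewrite (wh _ (braid_r0 _ _ _)) (cA _ (slide10 _ _)); nf.
by rewrite (compK _ (counitl_strict _ _)) -tensm_idl_comp counitl_strict
  tensm_id.
Qed.

Lemma tcounitr C D :
  runit _ ∘ (idm _ ⊠ tcounit C D) ∘ tcomul C D = idm _.
Proof.
rewrite /tcomul /tcounit /interchange; strict_goal W; fold_braid; nf.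
rewrite (wh _ (esym (slide_braid _ _ _))); nf; rewrite (wh _ (braid_l0 _ _ _)).
rewrite (wh _ (slide10 _ _)); nf.
rewrite (cA _ (counitr_strict _ _)) comp_idl -tensm_idl_comp.
by rewrite counitr_strict tensm_id.
Qed.

Lemma assoc_comul C D E :
  interchange _ _ _ _ ∘ (comul C ⊠ tcomul D E) ∘ assoc _ _ _
  = (assoc _ _ _ ⊠ assoc _ _ _)
    ∘ (interchange _ _ _ _ ∘ (tcomul C D ⊠ comul E)).
Proof.
rewrite /tcomul /interchange; strict_goal W; fold_braid.
rewrite sbraid_hex1 !sbraid_hex2; nf.
rewrite (cA _ (slide12 (comul C) _)); nf.
by rewrite (wh _ (slide_braid _ _ _)); nf.
Qed.

Definition tcoalg (C D : coalgebra) : coalgebra :=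
  Coalgebra (tcoassoc C D) (tcounitl C D) (tcounitr C D).

Lemma tensm_coalgP C C' D D' (f : coalg_mor C C') (g : coalg_mor D D') :
  is_coalg_mor (C := tcoalg C D) (D := tcoalg C' D') (cmap f ⊠ cmap g).
Proof.
case: f g => [f [f1 f2]] [g [g1 g2]]; split=> /=.
  rewrite /tcomul -(comp_assoc (interchange _ _ _ _)) -tensm_comp f1 g1.
  by rewrite tensm_comp (cA _ (interchange_nat _ _ _ _)) comp_assoc.
by rewrite /tcounit -comp_assoc -tensm_comp f2 g2.
Qed.

Lemma unit_coassoc :
  assoc _ _ _ ∘ (luniti 𝟏 ⊠ idm 𝟏) ∘ luniti 𝟏
  = (idm (𝟏 : M) ⊠ luniti 𝟏) ∘ luniti 𝟏.
Proof. by strict_goal W. Qed.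

Lemma unit_counitl : lunit _ ∘ (idm (𝟏 : M) ⊠ idm 𝟏) ∘ luniti 𝟏 = idm 𝟏.
Proof. by strict_goal W. Qed.

Lemma unit_counitr : runit _ ∘ (idm (𝟏 : M) ⊠ idm 𝟏) ∘ luniti 𝟏 = idm 𝟏.
Proof. by strict_goal W. Qed.

Definition ucoalg : coalgebra :=
  Coalgebra unit_coassoc unit_counitl unit_counitr.

Lemma assoc_coalgP C D E :
  is_coalg_mor (C := tcoalg (tcoalg C D) E) (D := tcoalg C (tcoalg D E))
    (assoc _ _ _).
Proof.
split=> /=; first exact: assoc_comul.
by rewrite /tcounit /= /tcounit; strict_goal W; nf.
Qed.

Lemma lunit_coalgP C : is_coalg_mor (C := tcoalg ucoalg C) (D := C) (lunit _).
Proof.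
split=> /=; last by rewrite /tcounit /= lunit_nat.
rewrite /tcomul /interchange /=; strict_goal W.
by fold_braid; rewrite sbraid1l !comp_idl.
Qed.

Lemma runit_coalgP C : is_coalg_mor (C := tcoalg C ucoalg) (D := C) (runit _).
Proof.
split=> /=; last by rewrite /tcounit /=; strict_goal W.
rewrite /tcomul /interchange /=; strict_goal W.
by fold_braid; rewrite sbraid1r tensm_id !comp_idl.
Qed.

Lemma inv_coalgP C D (f : Hom (carrier C) (carrier D)) g :
  g ∘ f = idm _ -> f ∘ g = idm _ ->
  is_coalg_mor f -> is_coalg_mor (C := D) (D := C) g.
Proof.
move=> gf fg [f1 f2]; split; last by rewrite -f2 -comp_assoc fg comp_idr.
rewrite -[comul C ∘ g]comp_idl -tensm_id -gf tensm_comp.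
by rewrite -comp_assoc (cA _ (esym f1)) -comp_assoc fg comp_idr.
Qed.

Lemma associ_coalgP C D E :
  is_coalg_mor (C := tcoalg C (tcoalg D E)) (D := tcoalg (tcoalg C D) E)
    (associ _ _ _).
Proof.
apply: (@inv_coalgP (tcoalg (tcoalg C D) E) (tcoalg C (tcoalg D E)) (assoc _ _ _)).
- exact: assocK.
- exact: associK.
exact: assoc_coalgP C D E.
Qed.

Lemma luniti_coalgP C :
  is_coalg_mor (C := C) (D := tcoalg ucoalg C) (luniti _).
Proof.
apply: (@inv_coalgP (tcoalg ucoalg C) (C) (lunit _)).
- exact: lunitK.
- exact: lunitiK.
exact: lunit_coalgP C.
Qed.

Lemma runiti_coalgP C :
  is_coalg_mor (C := C) (D := tcoalg C ucoalg) (runiti _).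
Proof.
apply: (@inv_coalgP (tcoalg C ucoalg) (C) (runit _)).
- exact: runitK.
- exact: runitiK.
exact: runit_coalgP C.
Qed.

Definition coalg_mon : monoidal.
Proof.
refine (@Monoidal coalg_cat tcoalg
  (fun C C' D D' f g => CoalgMor (tensm_coalgP f g))
  ucoalg
  (fun C D E => CoalgMor (assoc_coalgP C D E))
  (fun C D E => CoalgMor (associ_coalgP C D E))
  (fun C => CoalgMor (lunit_coalgP C))
  (fun C => CoalgMor (luniti_coalgP C))
  (fun C => CoalgMor (runit_coalgP C))
  (fun C => CoalgMor (runiti_coalgP C))
  _ _ _ _ _ _ _ _ _ _ _ _ _); move=> *; apply: coalg_mor_eq => /=.
- exact: tensm_id.
- exact: tensm_comp.
- exact: assoc_nat.
- exact: lunit_nat.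
- exact: runit_nat.
- exact: assocK.
- exact: associK.
- exact: lunitK.
- exact: lunitiK.
- exact: runitK.
- exact: runitiK.
- exact: triangle.
exact: pentagon.
Defined.

End Coalgebras.

Arguments comul {M} c.
Arguments counit {M} c.
Arguments cmap {M C D} c.

(* [ehom x y] plays the role of Hom(y, x). *)
Record ecategory (N : monoidal) (S : Type) := ECategory {
  ehom :> S -> S -> N;
  ecomp : forall x y z, Hom (ehom x y ⊗ ehom y z) (ehom x z);
  eid : forall x, Hom 𝟏 (ehom x x);
  ecomp_assoc : forall x y z t,
    ecomp x y t ∘ (idm _ ⊠ ecomp y z t) ∘ assoc _ _ _
    = ecomp x z t ∘ (ecomp x y z ⊠ idm _);
  ecomp_idl : forall x y, ecomp x x y ∘ (eid x ⊠ idm _) = lunit (ehom x y);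
  ecomp_idr : forall x y, ecomp x y y ∘ (idm _ ⊠ eid y) = runit (ehom x y)
}.

Arguments ecomp {N S} e x y z.
Arguments eid {N S} e x.

Definition forget (M : braided) (S : Type) (A : ecategory (coalg_mon M) S) :
  ecategory M S.
Proof.
refine (@ECategory M S (fun x y => carrier (A x y))
  (fun x y z => cmap (ecomp A x y z)) (fun x => cmap (eid A x)) _ _ _).
- by move=> x y z t; have /(congr1 cmap) := ecomp_assoc A x y z t.
- by move=> x y; have /(congr1 cmap) := ecomp_idl A x y.
by move=> x y; have /(congr1 cmap) := ecomp_idr A x y.
Defined.

Section Twisting.
Variables (S : Type) (nu : S -> S -> S -> S).

Definition twist_family (N : monoidal) (B A : ecategory N S) : Type :=
  forall x y z,
    Hom (B x y ⊗ A y z) (A x (nu x y z) ⊗ B (nu x y z) z).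

(* An equation such as [|xy|yzt|| = |xzt|] in [S] is needed for the composites
   below to typecheck; [rew [F] e in f] transports the codomain of [f] along
   it. *)
Record simple_twisting_system (N : monoidal) (B A : ecategory N S)
    (R : twist_family B A) : Prop := {
  twist_comp_left : forall x y z t,
    ~ initial (B x y ⊗ B y z ⊗ A z t) ->
    exists e : nu x y (nu y z t) = nu x z t,
      (idm _ ⊠ ecomp B (nu x z t) (nu y z t) t)
      ∘ assoc _ _ _
      ∘ ((rew [fun u => Hom _ (A x u ⊗ B u (nu y z t))] e
            in R x y (nu y z t)) ⊠ idm (B (nu y z t) t))
      ∘ associ _ _ _
      ∘ (idm (B x y) ⊠ R y z t)
      ∘ assoc _ _ _
      = R x z t ∘ (ecomp B x y z ⊠ idm (A z t));
  twist_comp_right : forall x y z t,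
    ~ initial (B x y ⊗ A y z ⊗ A z t) ->
    exists e : nu (nu x y z) z t = nu x y t,
      (ecomp A x (nu x y z) (nu x y t) ⊠ idm _)
      ∘ associ _ _ _
      ∘ (idm (A x (nu x y z))
           ⊠ (rew [fun u => Hom _ (A (nu x y z) u ⊗ B u t)] e
                in R (nu x y z) z t))
      ∘ assoc _ _ _
      ∘ (R x y z ⊠ idm (A z t))
      = R x y t ∘ (idm (B x y) ⊠ ecomp A y z t) ∘ assoc _ _ _;
  twist_unit_left : forall x y,
    ~ initial (A x y) ->
    exists e : nu x x y = y,
      (rew [fun u => Hom _ (A x u ⊗ B u y)] e in R x x y)
      ∘ (eid B x ⊠ idm (A x y)) ∘ luniti _
      = (idm (A x y) ⊠ eid B y) ∘ runiti _;
  twist_unit_right : forall x y,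
    ~ initial (B x y) ->
    exists e : nu x y y = x,
      (rew [fun u => Hom _ (A x u ⊗ B u y)] e in R x y y)
      ∘ (idm (B x y) ⊠ eid A y) ∘ runiti _
      = (eid A x ⊠ idm (B x y)) ∘ luniti _;
  twist_noninitial : forall x y z,
    ~ initial (B x y ⊗ A y z) ->
    ~ initial (A x (nu x y z) ⊗ B (nu x y z) z)
}.

Variables (M : braided) (B A : ecategory (coalg_mon M) S).
Variable R : twist_family B A.

Definition twist_forget : twist_family (forget B) (forget A) :=
  fun x y z => cmap (R x y z).

(* [rtri] is the family ▷ and [ltri] the family ◁. *)
Definition rtri x y z :
    Hom (forget B x y ⊗ forget A y z) (forget A x (nu x y z)) :=
  runit _ ∘ (idm _ ⊠ counit (B (nu x y z) z)) ∘ twist_forget x y z.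

Definition ltri x y z :
    Hom (forget B x y ⊗ forget A y z) (forget B (nu x y z) z) :=
  lunit _ ∘ (counit (A x (nu x y z)) ⊠ idm _) ∘ twist_forget x y z.

End Twisting.

Arguments simple_twisting_system {S nu N B A} R.
Arguments twist_forget {S nu M B A} R x y z.
Arguments rtri {S nu M B A} R x y z.
Arguments ltri {S nu M B A} R x y z.

(* Main.v *)
(* A coalgebra morphism f into D ⊗ E is determined by its two projections
   (D ⊗ ε) ∘ f and (ε ⊗ E) ∘ f, because f = ((D ⊗ ε) ∘ f ⊗ (ε ⊗ E) ∘ f) ∘ Δ.
   Both sides of each equation of a twisting system are coalgebra morphisms
   into such a tensor product, so the equation holds if and only if its two
   projections do; these are the two equations of the matching condition. *)

From Corelib Require Import ssreflect ssrfun.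
Require Import Defs.

Set Implicit Arguments.
Unset Strict Implicit.
Unset Printing Implicit Defensive.

(** * Recovering a coalgebra morphism from its two projections *)

Section Projections.
Variable M : braided.
Implicit Types C D E : coalgebra M.

Definition prl D E : Hom (carrier D ⊗ carrier E) (carrier D) :=
  runit _ ∘ (idm _ ⊠ counit E).

Definition prr D E : Hom (carrier D ⊗ carrier E) (carrier E) :=
  lunit _ ∘ (counit D ⊠ idm _).

Lemma slide21 (X Y X' Z Z' : M) (f : Hom (X ⊗ Y) X') (h : Hom Z Z') :
  lift (Wt (Wa X) (Wa Y)) (Wa X') f Z' ∘ (idm X ⊠ (idm Y ⊠ h))
  = (idm X' ⊠ h) ∘ lift (Wt (Wa X) (Wa Y)) (Wa X') f Z.
Proof. exact: (@lift_nat _ (Wt (Wa X) (Wa Y)) (Wa X')). Qed.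

Lemma slide22 (X Y X' Y' Z Z' : M) (f : Hom (X ⊗ Y) (X' ⊗ Y'))
    (h : Hom Z Z') :
  lift (Wt (Wa X) (Wa Y)) (Wt (Wa X') (Wa Y')) f Z' ∘ (idm X ⊠ (idm Y ⊠ h))
  = (idm X' ⊠ (idm Y' ⊠ h)) ∘ lift (Wt (Wa X) (Wa Y)) (Wt (Wa X') (Wa Y')) f Z.
Proof. exact: (@lift_nat _ (Wt (Wa X) (Wa Y)) (Wt (Wa X') (Wa Y'))). Qed.

(** The two counits hit the two middle factors, the ones that the braiding exchanges. By naturality
    the counit of [D] absorbs the braiding; what remains is the right counit law of [D] beside the
    left counit law of [E]. *)
Lemma prlr_tcomul D E : (prl D E ⊠ prr D E) ∘ tcomul D E = idm _.
Proof.
rewrite /prl /prr /tcomul /interchange; strict_goal W; fold_braid; nf.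
rewrite (wh _ (braid_l0 _ _ _)) (cA _ (counitr_strict _ _)) comp_idl.
by rewrite -tensm_idl_comp counitl_strict tensm_id.
Qed.

(** Since [f] preserves comultiplication, the comultiplication of [C] can be moved past [f], where
    it becomes that of [tcoalg D E] and [prlr_tcomul] applies. *)
Lemma prlr_comul C D E (f : coalg_mor C (tcoalg D E)) :
  ((prl D E ∘ f) ⊠ (prr D E ∘ f)) ∘ comul C = f.
Proof.
have [/= fD _] := cmapP f.
by rewrite tensm_comp -comp_assoc -fD comp_assoc prlr_tcomul comp_idl.
Qed.

Lemma coalg_mor_tens_ext C D E (f g : coalg_mor C (tcoalg D E)) :
  cmap f = g <-> prr D E ∘ f = prr D E ∘ g /\ prl D E ∘ f = prl D E ∘ g.
Proof.
split=> [-> //|[Er El]].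
by rewrite -(prlr_comul f) -(prlr_comul g) Er El.
Qed.

(** * Projections of the twisting equation for composition in [B] *)

Section Left.
Variables B1 B2 A1 A2 B3 A3 B4 B5 : coalgebra M.
Variable R1 : coalg_mor (tcoalg B2 A1) (tcoalg A2 B3).
Variable R2 : coalg_mor (tcoalg B1 A2) (tcoalg A3 B4).
Variable b : coalg_mor (tcoalg B4 B3) B5.

(** Composing in [coalg_mon] makes this a coalgebra morphism by construction. Arbitrary coalgebras
    stand for the hom-objects, so that no equality in [S] is needed to compose. *)
Definition twist_left :
    Hom (c := coalg_cat M) (tcoalg (tcoalg B1 B2) A1) (tcoalg A3 B5) :=
  (tensm (m := coalg_mon M) (idm _) b) ∘ assoc (m := coalg_mon M) A3 B4 B3
  ∘ (tensm (m := coalg_mon M) R2 (idm _)) ∘ associ (m := coalg_mon M) B1 A2 B3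
  ∘ (tensm (m := coalg_mon M) (idm _) R1) ∘ assoc (m := coalg_mon M) B1 B2 A1.

(** The counit of [A3] and [b] act on different tensor factors, so the counit passes [b] and turns
    [R2] into its right projection. *)
Lemma prr_twist_left :
  prr A3 B5 ∘ cmap twist_left
  = b ∘ ((prr A3 B4 ∘ R2) ⊠ idm _) ∘ associ _ _ _
    ∘ (idm _ ⊠ ((prl A2 B3 ∘ R1) ⊠ (prr A2 B3 ∘ R1)))
    ∘ (idm _ ⊠ tcomul B2 A1) ∘ assoc _ _ _.
Proof.
(* The two projections of [R1] recombine with the comultiplication into [R1] itself. *)
rewrite -(comp_assoc _ (idm _ ⊠ _) (idm _ ⊠ tcomul B2 A1)) -tensm_idl_comp.
rewrite (prlr_comul R1) /=.
case: R1 R2 b => [/= r1 _] [/= r2 _] [/= c _].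
by rewrite /prr; strict_goal W; nf; rewrite (cA _ (slide10 _ _)); nf.
Qed.

(** As [b] preserves counits, the counit of [B5] after [b] splits into those of [B4] and [B3]: the
    first cuts [R2] down to its left projection, the second does the same to [R1]. *)
Lemma prl_twist_left :
  prl A3 B5 ∘ cmap twist_left
  = prl A3 B4 ∘ R2 ∘ (idm _ ⊠ (prl A2 B3 ∘ R1)) ∘ assoc _ _ _.
Proof.
rewrite /=.
case: R1 R2 b => [/= r1 _] [/= r2 _] [/= c [_ /= cE]].
rewrite /tcounit in cE; strict_of cE cES.
rewrite /prl; strict_goal W; nf.
by rewrite (wh _ (cES _)) comp_idl; nf; rewrite (cA _ (slide22 _ _)); nf.
Qed.

Lemma twist_left_iff C (r : coalg_mor C (tcoalg A3 B5))
    (h : coalg_mor (tcoalg (tcoalg B1 B2) A1) C) :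
  cmap twist_left = r ∘ h <->
  prr A3 B5 ∘ r ∘ h
  = b ∘ ((prr A3 B4 ∘ R2) ⊠ idm _) ∘ associ _ _ _
    ∘ (idm _ ⊠ ((prl A2 B3 ∘ R1) ⊠ (prr A2 B3 ∘ R1)))
    ∘ (idm _ ⊠ tcomul B2 A1) ∘ assoc _ _ _ /\
  prl A3 B5 ∘ r ∘ h
  = prl A3 B4 ∘ R2 ∘ (idm _ ⊠ (prl A2 B3 ∘ R1)) ∘ assoc _ _ _.
Proof.
have := coalg_mor_tens_ext (comp (c := coalg_cat M) r h) twist_left.
rewrite prr_twist_left prl_twist_left -!(comp_assoc _ (cmap r)).
by case=> E1 E2; split=> [/esym /E1|/E2 /esym].
Qed.

End Left.

(** * Projections of the twisting equation for composition in [A] *)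

Section Right.
Variables B1 A1 A2 A3 B2 A4 B3 A5 : coalgebra M.
Variable R1 : coalg_mor (tcoalg B1 A1) (tcoalg A3 B2).
Variable R2 : coalg_mor (tcoalg B2 A2) (tcoalg A4 B3).
Variable a : coalg_mor (tcoalg A3 A4) A5.

Definition twist_right :
    Hom (c := coalg_cat M) (tcoalg (tcoalg B1 A1) A2) (tcoalg A5 B3) :=
  (tensm (m := coalg_mon M) a (idm _)) ∘ associ (m := coalg_mon M) A3 A4 B3
  ∘ (tensm (m := coalg_mon M) (idm _) R2) ∘ assoc (m := coalg_mon M) A3 B2 A2
  ∘ (tensm (m := coalg_mon M) R1 (idm _)).

Lemma prl_twist_right :
  prl A5 B3 ∘ cmap twist_right
  = a ∘ (idm _ ⊠ (prl A4 B3 ∘ R2)) ∘ assoc _ _ _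
    ∘ (((prl A3 B2 ∘ R1) ⊠ (prr A3 B2 ∘ R1)) ⊠ idm _)
    ∘ (tcomul B1 A1 ⊠ idm _).
Proof.
rewrite -(comp_assoc _ (_ ⊠ idm _) (tcomul B1 A1 ⊠ idm _)) -tensm_idr_comp.
rewrite (prlr_comul R1) /=.
case: R1 R2 a => [/= r1 _] [/= r2 _] [/= c _].
by rewrite /prl; strict_goal W; nf; rewrite (cA _ (esym (slide21 _ _))); nf.
Qed.

(** Here it is [a] that preserves counits: the counit of [A5] splits into those of [A3] and [A4],
    which leave the right projections of [R1] and [R2]. *)
Lemma prr_twist_right :
  prr A5 B3 ∘ cmap twist_right
  = prr A4 B3 ∘ R2 ∘ ((prr A3 B2 ∘ R1) ⊠ idm _).
Proof.
rewrite /=.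
case: R1 R2 a => [/= r1 _] [/= r2 _] [/= c [_ /= cE]].
rewrite /tcounit in cE; strict_of cE cES.
rewrite /prr; strict_goal W; nf.
rewrite (cA _ (cES _)) comp_idl; nf.
by do 2 (rewrite (cA _ (slide10 _ _)); nf).
Qed.

(** The extra factor [k] makes room for the associator that precedes [h] on the right of the
    twisting equation. *)
Lemma twist_right_iff C D (r : coalg_mor D (tcoalg A5 B3))
    (h : coalg_mor C D) (k : coalg_mor (tcoalg (tcoalg B1 A1) A2) C) :
  cmap twist_right = r ∘ h ∘ k <->
  prl A5 B3 ∘ r ∘ h ∘ k
  = a ∘ (idm _ ⊠ (prl A4 B3 ∘ R2)) ∘ assoc _ _ _
    ∘ (((prl A3 B2 ∘ R1) ⊠ (prr A3 B2 ∘ R1)) ⊠ idm _)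
    ∘ (tcomul B1 A1 ⊠ idm _) /\
  prr A5 B3 ∘ r ∘ h ∘ k
  = prr A4 B3 ∘ R2 ∘ ((prr A3 B2 ∘ R1) ⊠ idm _).
Proof.
have := coalg_mor_tens_ext
  (comp (c := coalg_cat M) (comp (c := coalg_cat M) r h) k) twist_right.
rewrite prr_twist_right prl_twist_right /= !comp_assoc.
case=> E1 E2; split=> [/esym /E1 []|[? ?]] //; exact/esym/E2.
Qed.

End Right.

(** * Projections of the two unit equations *)

Lemma twist_unit_left_iff B1 C D (r : coalg_mor (tcoalg B1 C) (tcoalg C D))
    (e1 : coalg_mor (ucoalg M) B1) (e : coalg_mor (ucoalg M) D) :
  r ∘ (e1 ⊠ idm _) ∘ luniti _ = (idm _ ⊠ e) ∘ runiti _ <->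
  prr C D ∘ r ∘ (e1 ⊠ idm _) ∘ luniti _
    = lunit _ ∘ (counit C ⊠ e) ∘ runiti _ /\
  prl C D ∘ r ∘ (e1 ⊠ idm _) ∘ luniti _ = idm _.
Proof.
have [_ /= eE] := cmapP e.
have E1 : prr C D ∘ ((idm _ ⊠ e) ∘ runiti _)
    = lunit _ ∘ (counit C ⊠ e) ∘ runiti _.
  by rewrite /prr -!comp_assoc (cA _ (esym (tensm_split _ _))).
(* The unit [e] preserves counits, so the counit of [D] after [e] is the identity of [𝟏]. *)
have E2 : prl C D ∘ ((idm _ ⊠ e) ∘ runiti _) = idm _.
  by rewrite /prl -!comp_assoc (cA _ (esym (tensm_idl_comp _ _ _))) eE
    tensm_id comp_idl runitiK.
have := coalg_mor_tens_ext
  (comp (c := coalg_cat M) r (comp (c := coalg_cat M)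
     (tensm (m := coalg_mon M) e1 (idm (c := coalg_cat M) C))
     (luniti (m := coalg_mon M) C)))
  (comp (c := coalg_cat M)
     (tensm (m := coalg_mon M) (idm (c := coalg_cat M) C) e)
     (runiti (m := coalg_mon M) C)).
by rewrite /= E1 E2 !comp_assoc.
Qed.

Lemma twist_unit_right_iff A1 C D (r : coalg_mor (tcoalg D A1) (tcoalg C D))
    (e1 : coalg_mor (ucoalg M) A1) (e : coalg_mor (ucoalg M) C) :
  r ∘ (idm _ ⊠ e1) ∘ runiti _ = (e ⊠ idm _) ∘ luniti _ <->
  prr C D ∘ r ∘ (idm _ ⊠ e1) ∘ runiti _ = idm _ /\
  prl C D ∘ r ∘ (idm _ ⊠ e1) ∘ runiti _
    = runit _ ∘ (e ⊠ counit D) ∘ luniti _.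
Proof.
have [_ /= eE] := cmapP e.
have E1 : prl C D ∘ ((e ⊠ idm _) ∘ luniti _)
    = runit _ ∘ (e ⊠ counit D) ∘ luniti _.
  by rewrite /prl -!comp_assoc (cA _ (esym (tensm_split' _ _))).
have E2 : prr C D ∘ ((e ⊠ idm _) ∘ luniti _) = idm _.
  by rewrite /prr -!comp_assoc (cA _ (esym (tensm_idr_comp _ _ _))) eE
    tensm_id comp_idl lunitiK.
have := coalg_mor_tens_ext
  (comp (c := coalg_cat M) r (comp (c := coalg_cat M)
     (tensm (m := coalg_mon M) (idm (c := coalg_cat M) D) e1)
     (runiti (m := coalg_mon M) D)))
  (comp (c := coalg_cat M)
     (tensm (m := coalg_mon M) e (idm (c := coalg_cat M) D))
     (luniti (m := coalg_mon M) D)).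
by rewrite /= E1 E2 !comp_assoc.
Qed.

End Projections.

(** One coalgebra morphism [r] accounts for all three transported maps, so the transport-free
    equivalences above apply to it. With [u] a variable, [e] can be eliminated and [r] is then
    [R x y z]. *)
Lemma twist_transport (M : braided) (S : Type)
    (A B : ecategory (coalg_mon M) S) (nu : S -> S -> S -> S)
    (R : twist_family nu B A) x y z u (e : nu x y z = u) :
  exists r : coalg_mor (tcoalg (B x y) (A y z)) (tcoalg (A x u) (B u z)),
    (rew [fun u => Hom _ (forget A x u ⊗ forget B u z)] e
       in twist_forget R x y z) = cmap r /\
    (rew [fun u => Hom _ (forget B u z)] e in ltri R x y z)
      = prr (A x u) (B u z) ∘ r /\
    (rew [fun u => Hom _ (forget A x u)] e in rtri R x y z)
      = prl (A x u) (B u z) ∘ r.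
Proof. by case: u / e; exists (R x y z). Qed.

(** * Equivalence of the twisting axioms with conditions (i) to (v) *)

Theorem theorem3p5 (M : braided) (S : Type)
    (A B : ecategory (coalg_mon M) S) (nu : S -> S -> S -> S)
    (R : twist_family nu B A) :
  let A' := forget A in
  let B' := forget B in
  simple_twisting_system (twist_forget R)
  <->
  forall x y z t : S,
    (* (i) *)
    (~ initial (B' x y ⊗ A' y z) ->
     ~ initial (A' x (nu x y z) ⊗ B' (nu x y z) z))
    /\
    (* (ii) *)
    (~ initial (B' x y ⊗ B' y z ⊗ A' z t) ->
     exists e : nu x y (nu y z t) = nu x z t,
       ltri R x z t ∘ (ecomp B' x y z ⊠ idm (A' z t))
       = ecomp B' (nu x z t) (nu y z t) t
         ∘ ((rew [fun u => Hom _ (B' u (nu y z t))] e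
               in ltri R x y (nu y z t)) ⊠ idm (B' (nu y z t) t))
         ∘ associ _ _ _
         ∘ (idm (B' x y) ⊠ (rtri R y z t ⊠ ltri R y z t))
         ∘ (idm (B' x y) ⊠ comul (tens (m := coalg_mon M) (B y z) (A z t)))
         ∘ assoc _ _ _
       /\
       rtri R x z t ∘ (ecomp B' x y z ⊠ idm (A' z t))
       = (rew [fun u => Hom _ (A' x u)] e in rtri R x y (nu y z t))
         ∘ (idm (B' x y) ⊠ rtri R y z t)
         ∘ assoc _ _ _)
    /\
    (* (iii) *)
    (~ initial (B' x y ⊗ A' y z ⊗ A' z t) ->
     exists e : nu (nu x y z) z t = nu x y t,
       rtri R x y t ∘ (idm (B' x y) ⊠ ecomp A' y z t) ∘ assoc _ _ _
       = ecomp A' x (nu x y z) (nu x y t)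
         ∘ (idm (A' x (nu x y z))
              ⊠ (rew [fun u => Hom _ (A' (nu x y z) u)] e
                   in rtri R (nu x y z) z t))
         ∘ assoc _ _ _
         ∘ ((rtri R x y z ⊠ ltri R x y z) ⊠ idm (A' z t))
         ∘ (comul (tens (m := coalg_mon M) (B x y) (A y z)) ⊠ idm (A' z t))
       /\
       ltri R x y t ∘ (idm (B' x y) ⊠ ecomp A' y z t) ∘ assoc _ _ _
       = (rew [fun u => Hom _ (B' u t)] e in ltri R (nu x y z) z t)
         ∘ (ltri R x y z ⊠ idm (A' z t)))
    /\
    (* (iv) *)
    (~ initial (A' x y) ->
     exists e : nu x x y = y,
       (rew [fun u => Hom _ (B' u y)] e in ltri R x x y)
       ∘ (eid B' x ⊠ idm (A' x y)) ∘ luniti _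
       = lunit _ ∘ (counit (A x y) ⊠ eid B' y) ∘ runiti _
       /\
       (rew [fun u => Hom _ (A' x u)] e in rtri R x x y)
       ∘ (eid B' x ⊠ idm (A' x y)) ∘ luniti _
       = idm (A' x y))
    /\
    (* (v) *)
    (~ initial (B' x y) ->
     exists e : nu x y y = x,
       (rew [fun u => Hom _ (B' u y)] e in ltri R x y y)
       ∘ (idm (B' x y) ⊠ eid A' y) ∘ runiti _
       = idm (B' x y)
       /\
       (rew [fun u => Hom _ (A' x u)] e in rtri R x y y)
       ∘ (idm (B' x y) ⊠ eid A' y) ∘ runiti _
       = runit _ ∘ (eid A' x ⊠ counit (B x y)) ∘ luniti _).
Proof.
rewrite /=; split=> [[H1 H2 H3 H4 H5] x y z t|H].
  split; first exact: H5.
  split=> [/H1 [e E]|].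
    (* Both sides use the same equality [e]; replacing the transported maps by [r] and its
       projections reduces the claim to one direction of [twist_left_iff]. *)
    exists e; move: E; have [r [-> [-> ->]]] := twist_transport R e.
    exact: (proj1 (twist_left_iff (R y z t) r (ecomp B _ _ _) (R x z t)
      (tensm (m := coalg_mon M) (ecomp B x y z) (idm (A z t))))).
  split=> [/H2 [e E]|].
    exists e; move: E; have [r [-> [-> ->]]] := twist_transport R e.
    exact: (proj1 (twist_right_iff (R x y z) r (ecomp A _ _ _) (R x y t)
      (tensm (m := coalg_mon M) (idm (B x y)) (ecomp A y z t))
      (assoc (m := coalg_mon M) _ _ _))).
  split=> [/H3 [e E]|/H4 [e E]].
    exists e; move: E; have [r [-> [-> ->]]] := twist_transport R e.
    exact: (proj1 (twist_unit_left_iff r (eid B x) (eid B y))).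
  exists e; move: E; have [r [-> [-> ->]]] := twist_transport R e.
  exact: (proj1 (twist_unit_right_iff r (eid A y) (eid A x))).
split=> [x y z t|x y z t|x y|x y|x y z].
- have [_ [Hl _]] := H x y z t; move/Hl=> [e E].
  exists e; move: E; have [r [-> [-> ->]]] := twist_transport R e.
  exact: (proj2 (twist_left_iff (R y z t) r (ecomp B _ _ _) (R x z t)
    (tensm (m := coalg_mon M) (ecomp B x y z) (idm (A z t))))).
- have [_ [_ [Hr _]]] := H x y z t; move/Hr=> [e E].
  exists e; move: E; have [r [-> [-> ->]]] := twist_transport R e.
  exact: (proj2 (twist_right_iff (R x y z) r (ecomp A _ _ _) (R x y t)
    (tensm (m := coalg_mon M) (idm (B x y)) (ecomp A y z t))
    (assoc (m := coalg_mon M) _ _ _))).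
(* Condition (iv) concerns [x] and [y] alone; [x] serves as an arbitrary element of [S] for the
   other two indices. *)
- have [_ [_ [_ [Hl _]]]] := H x y x x; move/Hl=> [e E].
  exists e; move: E; have [r [-> [-> ->]]] := twist_transport R e.
  exact: (proj2 (twist_unit_left_iff r (eid B x) (eid B y))).
- have [_ [_ [_ [_ Hr]]]] := H x y x x; move/Hr=> [e E].
  exists e; move: E; have [r [-> [-> ->]]] := twist_transport R e.
  exact: (proj2 (twist_unit_right_iff r (eid A y) (eid A x))).
- by have [] := H x y z x.
Qed.
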